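(* For every $d\ge 2$, $2\beta_{\mathrm{MM}}^d<\beta_{\mathrm{TSP}}^d$.
   Context: Let $x_1,x_2,\dots$ be independent uniformly random points of $[0,1]^d$ and $\mathcal{X}_n=\{x_1,\dots,x_n\}$. All lengths are Euclidean. For a finite set $X\subseteq\mathbb{R}^d$, $\mathrm{TSP}(X)$ is the minimum length of a traveling salesperson tour (closed Hamiltonian cycle) through $X$, and $\mathrm{MM}(X)$ is the minimum total length of a matching on $X$ covering all points (all but one point if $|X|$ is odd). For $L\in\{\mathrm{TSP},\mathrm{MM}\}$, $\beta_L^d$ is the constant such that $L(\mathcal{X}_n)/n^{(d-1)/d}\to\beta_L^d$ almost surely (known to exist). *)

(* Defs.v *)
From HB Require Import structures.
From mathcomp Require Import all_boot all_order all_algebra finmap.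
From mathcomp Require Import all_classical all_reals all_analysis.
Set Implicit Arguments.
Unset Strict Implicit.
Unset Printing Implicit Defensive.
Import Order.TTheory GRing.Theory Num.Theory.
Import numFieldNormedType.Exports.
Local Open Scope classical_set_scope.
Local Open Scope ring_scope.

(* Points of R^d are d.-tuples, whose library sigma-algebra is the product
   (hence Borel) one. *)

Definition eucl_dist (R : realType) (d : nat) (x y : d.-tuple R) : R :=
  Num.sqrt (\sum_(i < d) (tnth x i - tnth y i) ^+ 2).

(* [next s x] is the cyclic successor of [x] in [s], so this includes the edge
   from the last point of [s] back to the first. *)
Definition tour_length (R : realType) (d : nat) (s : seq (d.-tuple R)) : R :=
  \sum_(x <- s) eucl_dist x (next s x).

Definition is_tour (R : realType) (d : nat) (X : {fset d.-tuple R})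
    (s : seq (d.-tuple R)) : Prop :=
  uniq s /\ s =i X.

(* In [TSP] and [MM] the infimum is over a nonempty finite set of reals, so it
   is a minimum. *)
Definition TSP (R : realType) (d : nat) (X : {fset d.-tuple R}) : R :=
  inf [set tour_length s | s in is_tour X].

(* A matching is a list of edges {e.1, e.2} with all endpoints distinct. *)
Definition endpoints (R : realType) (d : nat)
    (m : seq (d.-tuple R * d.-tuple R)) : seq (d.-tuple R) :=
  unzip1 m ++ unzip2 m.

(* [odd] is coerced to nat: no point of [X] is left unmatched when [#|` X|] is
   even, exactly one when it is odd. *)
Definition is_matching (R : realType) (d : nat) (X : {fset d.-tuple R})
    (m : seq (d.-tuple R * d.-tuple R)) : Prop :=
  [/\ uniq (endpoints m),
      {subset endpoints m <= X} &
      #|` [fset x in X | x \notin endpoints m]%fset| = odd #|` X| :> nat].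

Definition matching_length (R : realType) (d : nat)
    (m : seq (d.-tuple R * d.-tuple R)) : R :=
  \sum_(e <- m) eucl_dist e.1 e.2.

Definition MM (R : realType) (d : nat) (X : {fset d.-tuple R}) : R :=
  inf [set matching_length m | m in is_matching X].

Definition mutually_independent (dT dS : measure_display)
    (T : measurableType dT) (S : measurableType dS) (R : realType)
    (P : probability T R) (I : choiceType) (x : I -> {RV P >-> S}) : Prop :=
  forall (J : {fset I}) (A : I -> set S),
    (forall i, i \in J -> measurable (A i)) ->
    P (\bigcap_(i in [set` J]) (x i @^-1` A i)) =
    (\prod_(i <- J) P (x i @^-1` A i))%E.

(* The uniform law on [0,1]^d is the d-fold product of the uniform law on [0,1],
   i.e. the Borel probability with the values below on measurable rectangles. *)
Definition uniform_on_cube (dT : measure_display) (T : measurableType dT)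
    (R : realType) (P : probability T R) (d : nat)
    (x : {RV P >-> d.-tuple R}) : Prop :=
  forall A : 'I_d -> set R, (forall i, measurable (A i)) ->
    distribution P x [set t | forall i, A i (tnth t i)] =
    (\prod_(i < d) uniform_prob (@ltr01 R) (A i))%E.

(* The informal x_1, x_2, ... is x 0, x 1, ... here. *)
Definition first_points (R : realType) (d : nat) (x : nat -> d.-tuple R)
    (n : nat) : {fset d.-tuple R} :=
  [fset x i | i in iota 0 n]%fset.

(* The constant beta_L^d, as the almost sure limit along the sample [x]. *)
Definition is_beta (dT : measure_display) (T : measurableType dT)
    (R : realType) (P : probability T R) (d : nat)
    (x : nat -> {RV P >-> d.-tuple R}) (L : {fset d.-tuple R} -> R)
    (beta : R) : Prop :=
  {ae P, forall w : T,
    L (first_points (fun i => x i w) n) / n%:R `^ ((d%:R - 1) / d%:R)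
      @[n --> \oo] --> beta}.

(* Main.v *)
Require Import Defs.
From HB Require Import structures.
From mathcomp Require Import all_boot all_order all_algebra finmap.
From mathcomp Require Import all_classical all_reals all_analysis.
From mathcomp Require Import measurable_realfun.
From mathcomp Require Import ring lra zify.
Set Implicit Arguments.
Unset Strict Implicit.
Unset Printing Implicit Defensive.
Import Order.TTheory GRing.Theory Num.Theory.
Import numFieldNormedType.Exports.
Local Open Scope classical_set_scope.
Local Open Scope ring_scope.

(* The alternate edges of a closed tour form two matchings, so [2 MM <= TSP]; the
   point is to gain a fixed proportion. Cut the cube into [k ^ d] cells of side
   [1 / k] and throw in a number of points proportional to [k ^ d]. With
   probability bounded below, the points in a given cell form a gadget: sixteen
   tight pairs, arranged in a small four by four grid in the middle of the cell,
   and nothing else. By two-opt moves, an optimal tour leaves a gadget at most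
   twice, since three long edges leaving a small set cannot be pairwise almost
   opposite. Hence it spends at least fourteen grid steps inside the gadget,
   while contracting the gadget to its centre lengthens the at most four edges
   crossing its boundary by less than that. So a tour through the points outside
   all gadgets is shorter than the optimal tour by a constant times [1 / k] per
   gadget; its two matchings are completed by matching the tight pairs, at a
   negligible cost. In expectation a fixed proportion of the cells contain
   gadgets, so the gain survives the normalisation, by dominated convergence. *)

(** * Path lengths *)

(** [D] is an arbitrary function, so that the same lemmas apply to a distance pulled back along a
    map, as in [clen_filter_contract]. *)
Fixpoint plen {R : realFieldType} {T : Type} (D : T -> T -> R) (x : T)
    (p : seq T) : R :=
  if p is y :: p' then D x y + plen D y p' else 0.

Definition clen {R : realFieldType} {T : Type} (D : T -> T -> R) (s : seq T) : R :=
  if s is x :: p then plen D x (rcons p x) else 0.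

Lemma plen_cat {R : realFieldType} {T : Type} (D : T -> T -> R) x p q :
  plen D x (p ++ q) = plen D x p + plen D (last x p) q.
Proof. by elim: p x => [|y p IH] x /=; rewrite ?add0r // IH addrA. Qed.

Lemma plen_rev {R : realFieldType} {T : Type} (D : T -> T -> R) x y p :
  (forall u v, D u v = D v u) ->
  plen D x (rcons (rev p) y) = plen D y (rcons p x).
Proof.
move=> DC; elim: p x y => [|z p IH] x y /=; first by rewrite DC.
rewrite rev_cons -cats1 plen_cat last_rcons /= IH addr0.
by rewrite addrC DC.
Qed.

Lemma plen_map {R : realFieldType} {S T : Type} (D : T -> T -> R) (h : S -> T) x p :
  plen D (h x) (map h p) = plen (fun u v => D (h u) (h v)) x p.
Proof. by elim: p x => [|y p IH] x //=; rewrite IH. Qed.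

Lemma plen_fpath {R : realFieldType} {T : eqType} (D : T -> T -> R) f x p :
  fpath f x p -> plen D x p = \sum_(u <- belast x p) D u (f u).
Proof.
elim: p x => [|y p IH] x /=; first by rewrite big_nil.
by move=> /andP[/eqP <- /IH ->]; rewrite big_cons.
Qed.

Lemma clen_next {R : realFieldType} {T : eqType} (D : T -> T -> R) s :
  uniq s -> clen D s = \sum_(x <- s) D x (next s x).
Proof.
move=> Us; have := cycle_next Us; case: s Us => [|x p] Us; first by rewrite big_nil.
by move=> /plen_fpath; rewrite /clen => ->; rewrite belast_rcons.
Qed.

Lemma clen_rot {R : realFieldType} {T : eqType} (D : T -> T -> R) n s :
  uniq s -> clen D (rot n s) = clen D s.
Proof.
move=> Us; rewrite !clen_next ?rot_uniq // (perm_big s) /=; last by rewrite perm_rot.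
by apply: eq_bigr => x _; rewrite next_rot.
Qed.

(** [next s] runs through all of [s] in one cycle. In [gadget_gain] this keeps the two points of a
    cluster from closing up on themselves. *)
Lemma mem_next_closed {T : eqType} (s : seq T) (C : pred T) x :
  uniq s -> (forall y, y \in s -> C y -> C (next s y)) -> x \in s -> C x ->
  all C s.
Proof.
move=> Us HC xs Cx; have [i p Ep] := rot_to xs.
have := cycle_next Us; rewrite -(rot_cycle i) Ep /= => Hp.
have /eq_all_r -> : s =i x :: p by move=> y; rewrite -Ep mem_rot.
have {Hp} : fpath (next s) x p by move: Hp; rewrite rcons_path => /andP[].
have : {subset x :: p <= s} by move=> y; rewrite -Ep mem_rot.
move=> {Ep xs}; elim: p x Cx => [|y p IH] x Cx sub /=; first by rewrite Cx.
case/andP=> /eqP <- Hp; rewrite Cx /=; apply: IH => //.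
  by apply: HC => //; apply: sub; rewrite mem_head.
by move=> z; rewrite inE => /predU1P[->|zp]; rewrite ?mem_next;
  apply: sub; rewrite !inE ?eqxx ?zp ?orbT.
Qed.

(* Reversing the stretch between two edges of a closed tour reconnects their
   tails to each other and their heads to each other. *)
Lemma two_opt {R : realFieldType} {T : eqType} (D : T -> T -> R) s a b :
  (forall u v, D u v = D v u) -> uniq s -> a \in s -> b \in s -> a != b ->
  exists2 s', perm_eq s' s &
    clen D s' + (D a (next s a) + D b (next s b)) =
    clen D s + (D a b + D (next s a) (next s b)).
Proof.
move=> DC Us as_ bs ab; have [i p Ep] := rot_to as_.
have bp : b \in p by move: bs; rewrite -(mem_rot i) Ep inE eq_sym (negbTE ab).
have := cycle_next Us; rewrite -(rot_cycle i) Ep -(clen_rot D i Us) Ep.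
have Pp : perm_eq (a :: p) s by rewrite -Ep perm_rot.
case/path.splitP: bp Pp {Ep} => p1 p2 Pp /=.
rewrite rcons_cat cat_path last_rcons plen_cat last_rcons.
case E2 : (rcons p2 a) => [|y r]; first by case: p2 E2 {Pp}.
move=> /and3P[H1 /eqP nb _].
(* The rotated tour is [a], [p1], [b], [p2], and [y] follows [b]. If [p1] is empty, then [b] follows
   [a] and the tour itself serves; otherwise the stretch from [c] to [b] is reversed. *)
case: p1 Pp H1 => [|c p1] Pp /=.
  move=> /andP[/eqP na _]; exists (a :: b :: p2) => //.
  by rewrite /= E2 /= na nb; ring.
move=> /andP[/eqP na _]; exists (a :: b :: rcons (rev p1) c ++ p2).
  apply: perm_trans Pp; apply/permP => Q.
  by rewrite /= -!cats1 !count_cat count_rev /=; lia.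
rewrite /= rcons_cat plen_cat last_rcons E2 /= na nb plen_rev //; ring.
Qed.

(** Points of [P] stay in place, and skipping the image of any other point does not lengthen the
    path, by the triangle inequality. The end [z] guarantees that a skipped point has a
    successor. *)
Lemma plen_filter_contract {R : realFieldType} {T : eqType} (D : T -> T -> R)
    (P : pred T) (h : T -> T) x p z :
  (forall u v w, D u w <= D u v + D v w) -> (forall u, P u -> h u = u) ->
  plen D x (rcons (seq.filter P p) z) <= plen D x (rcons (map h p) z).
Proof.
move=> tri hP; elim: p x => [|y p IH] x //=.
case: ifP => [Py|_] /=; first by rewrite hP // lerD2l.
apply: le_trans (_ : D x (h y) + plen D (h y) (rcons (seq.filter P p) z) <= _); last first.
  by rewrite lerD2l.
by case: (rcons _ z) (size_rcons (seq.filter P p) z) => //= u q _; rewrite addrA lerD2r.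
Qed.

(* A rotation is needed because the tour must start at a point fixed by [h]. *)
Lemma clen_filter_contract {R : realFieldType} {T : eqType} (D : T -> T -> R)
    (P : pred T) (h : T -> T) s :
  (forall u v, 0 <= D u v) -> (forall u v w, D u w <= D u v + D v w) ->
  (forall u, P u -> h u = u) -> uniq s ->
  exists2 s', perm_eq s' (seq.filter P s) &
    clen D s' <= \sum_(x <- s) D (h x) (h (next s x)).
Proof.
move=> D0 tri hP Us.
have [/hasP[x xs Px]|noP] := boolP (has P s); last first.
  exists [::]; last by apply: sumr_ge0 => *; apply: D0.
  by rewrite (_ : seq.filter P s = [::]) //; apply/eqP; rewrite -[_ == _]negbK -has_filter.
rewrite -(clen_next (fun u v => D (h u) (h v)) Us).
have [i p Ep] := rot_to xs; rewrite -(clen_rot _ i Us) Ep.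
exists (x :: seq.filter P p).
  have := perm_filter P (s1 := rot i s) (s2 := s); rewrite perm_rot Ep /= Px.
  exact.
by rewrite /= -(plen_map D h) map_rcons (hP x) //; apply: plen_filter_contract.
Qed.

(** * Splitting a closed tour into two matchings *)

Fixpoint pairs {T : Type} (s : seq T) : seq (T * T) :=
  if s is x :: s1 then if s1 is y :: s2 then (x, y) :: pairs s2 else [::]
  else [::].

Lemma seq_ind2 {T : Type} (Q : seq T -> Prop) :
  Q [::] -> (forall x, Q [:: x]) -> (forall x y s, Q s -> Q [:: x, y & s]) ->
  forall s, Q s.
Proof.
move=> Q0 Q1 Q2 s; suff: Q s /\ forall x, Q (x :: s) by case.
by elim: s => [|y s [IH1 IH2]]; split => // x; apply: Q2.
Qed.

Lemma perm_pairs {T : eqType} (s : seq T) :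
  exists2 r, perm_eq s (unzip1 (pairs s) ++ unzip2 (pairs s) ++ r) &
    size r = odd (size s).
Proof.
elim/(@seq_ind2 T): s => [|x|x y s [r Pr sr]]; first by exists [::].
  by exists [:: x].
exists r; last by rewrite /= negbK.
rewrite /= perm_cons -[y :: _ ++ r]cat1s perm_sym perm_catCA /= perm_cons.
by rewrite perm_sym.
Qed.

(** The edges of a path fall alternately into two matchings, one starting at its first vertex and
    one at its second. *)
Lemma sum_pairs_plen {R : realFieldType} {T : Type} (D : T -> T -> R) x p :
  \sum_(e <- pairs (x :: p)) D e.1 e.2 + \sum_(e <- pairs p) D e.1 e.2 =
  plen D x p.
Proof.
elim: p x => [|y p IH] x; first by rewrite !big_nil addr0.
by rewrite [plen _ _ _]/= -IH [pairs (x :: _)]/= big_cons /= -addrA; congr (_ + _); rewrite addrC.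
Qed.

Lemma sum_pairs_rcons {R : realFieldType} {T : Type} (D : T -> T -> R) s z :
  (forall u v, 0 <= D u v) ->
  \sum_(e <- pairs s) D e.1 e.2 <= \sum_(e <- pairs (rcons s z)) D e.1 e.2.
Proof.
move=> D0; elim/(@seq_ind2 T): s => [|x|x y s IH]; rewrite /= ?big_nil ?big_cons //.
- by rewrite big_nil addr0.
- by rewrite lerD2l.
Qed.

(** The path [x :: rcons p x] splits into two alternating matchings, and the one from its second
    vertex lives on [rot 1 s]. When [size s] is odd the closing edge is in neither list, hence only
    an inequality. *)
Lemma sum_pairs_clen {R : realFieldType} {T : Type} (D : T -> T -> R) s :
  (forall u v, 0 <= D u v) ->
  \sum_(e <- pairs s) D e.1 e.2 + \sum_(e <- pairs (rot 1 s)) D e.1 e.2 <= clen D s.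
Proof.
move=> D0; case: s => [|x p]; first by rewrite !big_nil addr0.
by rewrite rot1_cons /clen -sum_pairs_plen lerD2r -rcons_cons; apply: sum_pairs_rcons.
Qed.

Lemma seq_argmin {R : realFieldType} {T : eqType} (f : T -> R) (s : seq T) x :
  x \in s -> exists2 y, y \in s & forall z, z \in s -> f y <= f z.
Proof.
elim: s x => [//|a s IH] x _; case: s IH => [_|b s IH].
  by exists a; rewrite ?mem_head // => z; rewrite inE => /eqP ->.
have [y ys Hy] := IH b (mem_head _ _); have [le|lt] := leP (f a) (f y).
  exists a; rewrite ?mem_head // => z; rewrite inE => /predU1P[->//|/Hy].
  exact: le_trans.
exists y; first by rewrite inE ys orbT.
by move=> z; rewrite inE => /predU1P[->|/Hy//]; apply: ltW.
Qed.

(** * Euclidean geometry *)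

Section Euclid.
Context {R : realType} {d : nat}.
Implicit Types (u v w : 'I_d -> R) (x y z : d.-tuple R).

Definition dot u v : R := \sum_(i < d) u i * v i.
Definition nrm u : R := Num.sqrt (dot u u).

Lemma dot_ge0 u : 0 <= dot u u.
Proof. by apply: sumr_ge0 => i _; rewrite -expr2 sqr_ge0. Qed.

Lemma nrm_ge0 u : 0 <= nrm u. Proof. exact: sqrtr_ge0. Qed.

Lemma nrm_sqr u : nrm u ^+ 2 = dot u u.
Proof. by rewrite sqr_sqrtr // dot_ge0. Qed.

Lemma nrm_eq0 u : nrm u = 0 -> forall i, u i = 0.
Proof.
move=> u0 i; have : dot u u == 0 by rewrite -nrm_sqr u0 expr0n.
rewrite psumr_eq0 => [/allP/(_ i)|j _]; last by rewrite -expr2 sqr_ge0.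
by rewrite mem_index_enum mulf_eq0 orbb => /(_ isT)/eqP.
Qed.

Lemma dot_comb3 (a b c : R) u v w :
  let f i := a * u i + b * v i + c * w i in
  dot f f = a ^+ 2 * dot u u + b ^+ 2 * dot v v + c ^+ 2 * dot w w
    + 2 * (a * b * dot u v + a * c * dot u w + b * c * dot v w).
Proof.
rewrite /= /dot !mulr_sumr -!big_split /= mulr_sumr -big_split /=.
by apply: eq_bigr => i _; ring.
Qed.

(** Cauchy-Schwarz, from the squared norm of [nrm v * u - nrm u * v]. *)
Lemma dot_le u v : dot u v <= nrm u * nrm v.
Proof.
have [u0|u0] := eqVneq (nrm u) 0.
  by rewrite u0 mul0r /dot big1 // => i _; rewrite (nrm_eq0 u0) mul0r.
have [v0|v0] := eqVneq (nrm v) 0.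
  by rewrite v0 mulr0 /dot big1 // => i _; rewrite (nrm_eq0 v0) mulr0.
have upos : 0 < nrm u by rewrite lt_def u0 nrm_ge0.
have vpos : 0 < nrm v by rewrite lt_def v0 nrm_ge0.
have := dot_ge0 (fun i => nrm v * u i + (- nrm u) * v i + 0 * u i).
rewrite dot_comb3 -!nrm_sqr.
have -> : nrm v ^+ 2 * nrm u ^+ 2 + (- nrm u) ^+ 2 * nrm v ^+ 2 + 0 ^+ 2 * nrm u ^+ 2
  + 2 * (nrm v * - nrm u * dot u v + nrm v * 0 * nrm u ^+ 2 + - nrm u * 0 * dot v u)
  = (2 * (nrm u * nrm v)) * (nrm u * nrm v - dot u v) by ring.
by rewrite pmulr_rge0 ?subr_ge0 // !mulr_gt0.
Qed.

Lemma nrmD u v : nrm (fun i => u i + v i) <= nrm u + nrm v.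
Proof.
rewrite -ler_sqr ?nnegrE ?addr_ge0 ?nrm_ge0 // nrm_sqr sqrrD !nrm_sqr.
have -> : dot (fun i => u i + v i) (fun i => u i + v i) =
          dot u u + 2 * dot u v + dot v v.
  rewrite /dot mulr_sumr -!big_split /=; apply: eq_bigr => i _; ring.
by have := dot_le u v; lra.
Qed.

(* At least two of three directions make an angle of at most 120 degrees, so
   three pairwise almost opposite vectors cannot be long. *)
Lemma three_directions (E r : R) (v : 'I_3 -> 'I_d -> R) :
  0 < r -> 4 * E < r -> (forall i, r <= nrm (v i)) ->
  ~ (forall i j, i != j ->
      nrm (v i) + nrm (v j) <= nrm (fun l => v i l - v j l) + E).
Proof.
move=> r0 Er rv H.
have E0 : 0 <= E.
  have := H 0 1 isT; have := nrmD (v 0) (fun l => - v 1 l).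
  have -> : nrm (fun l => - v 1 l) = nrm (v 1).
    by congr Num.sqrt; apply: eq_bigr => i _; rewrite mulrNN.
  by lra.
have pos i : 0 < nrm (v i) by apply: lt_le_trans (rv i).
(* Squaring the hypothesis bounds the cosine of the angle between [v i] and [v j] by
   [2 * E / r - 1], which is below [-1/2]. *)
have dotij i j : i != j -> (nrm (v i))^-1 * (nrm (v j))^-1 * dot (v i) (v j)
     <= 2 * E / r - 1.
  move=> ij; have {}H := H i j ij; move: (pos i) (pos j) (rv i) (rv j) => pi pj ri rj.
  have sq : (nrm (v i) + nrm (v j) - E) ^+ 2 <= nrm (fun l => v i l - v j l) ^+ 2.
    by rewrite ler_sqr ?nnegrE ?nrm_ge0 //; lra.
  rewrite nrm_sqr in sq.
  have eqd : dot (fun l => v i l - v j l) (fun l => v i l - v j l) =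
     nrm (v i) ^+ 2 + nrm (v j) ^+ 2 - 2 * dot (v i) (v j).
    rewrite !nrm_sqr /dot mulr_sumr -sumrN -!big_split /=; apply: eq_bigr => l _; ring.
  rewrite eqd in sq.
  have le : dot (v i) (v j) <= E * (nrm (v i) + nrm (v j)) - nrm (v i) * nrm (v j).
    have := sqr_ge0 E; set a := nrm _ in sq *; set b := nrm _ in sq *.
    have sqE : (a + b - E) ^+ 2 =
        a ^+ 2 + b ^+ 2 + 2 * (a * b) - 2 * (E * (a + b)) + E ^+ 2 by ring.
    by rewrite sqE in sq; lra.
  have iv (t : R) : r <= t -> t^-1 <= r^-1.
    by move=> rt; rewrite lef_pV2 ?posrE //; apply: lt_le_trans rt.
  apply: le_trans (_ : (nrm (v i))^-1 * (nrm (v j))^-1 *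
      (E * (nrm (v i) + nrm (v j)) - nrm (v i) * nrm (v j)) <= _).
    by rewrite ler_wpM2l // mulr_ge0 // invr_ge0 ltW.
  have -> : (nrm (v i))^-1 * (nrm (v j))^-1 *
      (E * (nrm (v i) + nrm (v j)) - nrm (v i) * nrm (v j)) =
      E * (nrm (v j))^-1 + E * (nrm (v i))^-1 - 1.
    by field; rewrite !gt_eqF.
  have := ler_wpM2l E0 (iv _ ri); have := ler_wpM2l E0 (iv _ rj).
  by rewrite -[2 * E / r]mulrA; lra.
(* Three unit vectors with pairwise products below [-1/2] would have a sum of negative squared
   norm. *)
have := dot_ge0 (fun l => (nrm (v 0))^-1 * v 0 l + (nrm (v 1))^-1 * v 1 l
   + (nrm (v 2))^-1 * v 2 l).
rewrite dot_comb3 -!nrm_sqr -!exprMn !mulVf ?gt_eqF ?pos // !expr1n.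
have := dotij 0 1 isT; have := dotij 0 2 isT; have := dotij 1 2 isT.
have : E / r < 1 / 4 by rewrite ltr_pdivrMr //; lra.
rewrite -mulrA; lra.
Qed.

Lemma eucl_nrm x y : eucl_dist x y = nrm (fun i => tnth x i - tnth y i).
Proof. by congr Num.sqrt; apply: eq_bigr => i _; rewrite expr2. Qed.

Lemma eucl_ge0 x y : 0 <= eucl_dist x y. Proof. exact: sqrtr_ge0. Qed.

Lemma euclC x y : eucl_dist x y = eucl_dist y x.
Proof. by congr Num.sqrt; apply: eq_bigr => i _; rewrite -sqrrN opprB. Qed.

Lemma euclxx x : eucl_dist x x = 0.
Proof. by rewrite /eucl_dist big1 ?sqrtr0 // => i _; rewrite subrr expr0n. Qed.

Lemma eucl_tri x y z : eucl_dist x z <= eucl_dist x y + eucl_dist y z.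
Proof.
rewrite !eucl_nrm; apply: le_trans (nrmD _ _); rewrite le_eqVlt.
apply/orP; left; apply/eqP; congr nrm; apply/funext => i; ring.
Qed.

Lemma eucl_coord x y i : `|tnth x i - tnth y i| <= eucl_dist x y.
Proof.
rewrite -sqrtr_sqr ler_wsqrtr // (bigD1 i) //= lerDl.
by apply: sumr_ge0 => j _; rewrite sqr_ge0.
Qed.

(** Upper bounds on distances in a cell are computed coordinatewise through this; the factor [d]
    that it may cost is absorbed by [tau]. *)
Lemma eucl_l1 x y : eucl_dist x y <= \sum_(i < d) `|tnth x i - tnth y i|.
Proof.
rewrite -ler_sqr ?nnegrE ?eucl_ge0 ?sumr_ge0 // sqr_sqrtr; last first.
  by apply: sumr_ge0 => i _; rewrite sqr_ge0.
rewrite expr2 mulr_suml ler_sum // => i _.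
rewrite -real_normK ?num_real // expr2 ler_wpM2l //.
by rewrite (bigD1 i) //= lerDl sumr_ge0.
Qed.

End Euclid.

(** * Gadgets in an optimal tour *)

(** [next s] permutes [s], so differences of a potential along a tour sum to zero, as needed in
    [contract_gain]. *)
Lemma sum_next {R : realFieldType} {T : eqType} (s : seq T) (F : T -> R) :
  uniq s -> \sum_(x <- s) F (next s x) = \sum_(x <- s) F x.
Proof.
move=> Us; rewrite -(big_map (next s) xpredT F); apply: perm_big.
apply: uniq_perm => //.
  by rewrite map_inj_uniq //; exact: can_inj (prev_next Us).
move=> x; apply/mapP/idP => [[y ys ->]|xs]; first by rewrite mem_next.
by exists (prev s x); rewrite ?mem_prev ?next_prev.
Qed.

(* [a true j] and [a false j] are the two points of the [j]-th cluster of a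
   gadget that occupies the region [Q] around [c]. *)
Record gadget {R : realType} {d m : nat} (rho delta eps r : R)
    (s : seq (d.-tuple R)) (Q : pred (d.-tuple R)) (c : d.-tuple R)
    (a : bool -> 'I_m -> d.-tuple R) : Prop := Gadget {
  gadget_mem : forall t j, a t j \in s;
  gadget_in : forall t j, Q (a t j);
  gadget_inj : forall t t' j j', a t j = a t' j' -> t = t' /\ j = j';
  gadget_only : forall x, x \in s -> Q x -> exists t j, x = a t j;
  gadget_rad : forall t j, eucl_dist c (a t j) <= rho;
  gadget_sep : forall t t' j j', j != j' -> delta <= eucl_dist (a t j) (a t' j');
  gadget_pair : forall j, eucl_dist (a true j) (a false j) <= eps;
  gadget_far : forall x, x \in s -> ~~ Q x -> r <= eucl_dist c x }.

Section Tour.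
Context {R : realType} {d : nat}.
Implicit Types (x y c : d.-tuple R) (s : seq (d.-tuple R)).
Local Notation D := (@eucl_dist R d).

Definition optimal s := forall s', perm_eq s' s -> clen D s <= clen D s'.

Lemma optimal_two_opt s x y : uniq s -> optimal s -> x \in s -> y \in s ->
  x != y -> D x (next s x) + D y (next s y) <= D x y + D (next s x) (next s y).
Proof.
move=> Us opt xs ys xy; have [s' Ps' E] := two_opt (@euclC R d) Us xs ys xy.
by have := opt _ Ps'; lra.
Qed.

(** Let [v] be the vectors from [c] to the heads of three exit edges, whose tails are within [rho]
    of [c]. Failure of the two-opt moves to shorten the tour makes these vectors pairwise almost
    opposite with error [4 * rho], against [three_directions]. *)
Lemma count_exits s (Q : pred (d.-tuple R)) c (rho r : R) :
  uniq s -> optimal s -> 0 < r -> 16 * rho < r ->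
  (forall x, x \in s -> Q x -> D c x <= rho) ->
  (forall x, x \in s -> ~~ Q x -> r <= D c x) ->
  (count (fun x => Q x && ~~ Q (next s x)) s <= 2)%N.
Proof.
move=> Us opt r0 rr near far; rewrite leqNgt; apply/negP; rewrite -size_filter.
set l := seq.filter _ s => sl; have Ul : uniq l by apply: filter_uniq.
have lP i : (i < 3)%N -> [/\ nth c l i \in s, Q (nth c l i) & ~~ Q (next s (nth c l i))].
  move=> i3; have : nth c l i \in l by apply: mem_nth; apply: leq_trans sl.
  by rewrite mem_filter => /andP[/andP[-> ->] ->].
pose v (i : 'I_3) (k : 'I_d) := tnth (next s (nth c l i)) k - tnth c k.
have nv i : nrm (v i) = D (next s (nth c l i)) c by rewrite eucl_nrm.
have vv i j : nrm (fun k => v i k - v j k) = D (next s (nth c l i)) (next s (nth c l j)).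
  by rewrite eucl_nrm; congr nrm; apply/funext => k; rewrite /v; ring.
apply: (@three_directions _ _ (4 * rho) r v) => //; first lra.
  move=> i; have [si _ ni] := lP i (ltn_ord i).
  by rewrite nv euclC; apply: far; rewrite ?mem_next.
move=> i j ij; rewrite !nv vv.
have [si Qi _] := lP i (ltn_ord i); have [sj Qj _] := lP j (ltn_ord j).
have nij : nth c l i != nth c l j.
  by rewrite nth_uniq //; apply: leq_trans sl.
have := optimal_two_opt Us opt si sj nij.
have := near _ si Qi; have := near _ sj Qj.
have := eucl_tri (next s (nth c l i)) (nth c l i) c.
have := eucl_tri (next s (nth c l j)) (nth c l j) c.
have := eucl_tri (nth c l i) c (nth c l j).
rewrite (euclC (nth c l i) c) (euclC (nth c l j) c).
rewrite (euclC (next s (nth c l i)) (nth c l i)) (euclC (next s (nth c l j)) (nth c l j)).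
lra.
Qed.

Lemma perm_gadget (m : nat) (rho delta eps r : R) s Q c (a : bool -> 'I_m -> _) :
  gadget rho delta eps r s Q c a -> uniq s ->
  perm_eq (seq.filter Q s) (map (a true) (enum 'I_m) ++ map (a false) (enum 'I_m)).
Proof.
move=> G Us; apply: uniq_perm; first exact: filter_uniq.
  have inj t : injective (a t) by move=> j j' /(gadget_inj G)[].
  rewrite cat_uniq !(map_inj_uniq (inj _)) enum_uniq andbT /=.
  apply/hasPn => _ /mapP[j _ ->]; apply/mapP => -[j' _].
  by move=> /(gadget_inj G)[].
move=> x; rewrite mem_filter mem_cat; apply/andP/orP.
  move=> [Qx xs]; have [[] [j ->]] := gadget_only G xs Qx.
    by left; apply: map_f; rewrite mem_enum.
  by right; apply: map_f; rewrite mem_enum.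
by case=> /mapP[j _ ->]; rewrite (gadget_in G) (gadget_mem G).
Qed.

(** Each cluster without exit sends an edge of length at least [delta] to another cluster. There are
    at most two exits; each may spoil one cluster and is charged [2 * rho], the price of contraction
    in [contract_gain]. *)
Lemma gadget_gain (m : nat) (rho delta eps r : R) s Q c (a : bool -> 'I_m -> _) :
  gadget rho delta eps r s Q c a -> uniq s -> optimal s -> (1 < m)%N ->
  0 <= rho -> 0 <= delta -> 0 < r -> 16 * rho < r ->
  m%:R * delta - 2 * (2 * rho + delta) <=
  \sum_(x <- s | Q x) (if Q (next s x) then D x (next s x) else - (2 * rho)).
Proof.
move=> G Us opt m1 rho0 delta0 r0 rr.
have mem_ := gadget_mem G; have in_ := gadget_in G.
have only := gadget_only G; have sep := gadget_sep G.
have inj := gadget_inj G.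
pose val x := if Q (next s x) then D x (next s x) else - (2 * rho).
rewrite -[leRHS]/(\sum_(x <- s | Q x) val x).
pose e x : R := (~~ Q (next s x))%:R.
have sumQ F : \sum_(x <- s | Q x) F x = \sum_(j < m) (F (a true j) + F (a false j)) :> R.
  by rewrite -big_filter (perm_big _ (perm_gadget G Us)) big_cat /= !big_image -big_split.
have valE x : val x = (1 - e x) * D x (next s x) - e x * (2 * rho).
  by rewrite /val /e; case: (Q _) => /=; ring.
have exits : \sum_(x <- s | Q x) e x <= 2.
  have := count_exits Us opt r0 rr _ (gadget_far G).
  rewrite -sum1_count big_mkcondr /= => H; rewrite -natr_sum ler_nat.
  under eq_bigr do rewrite -[nat_of_bool _]/(if _ then _ else _).
  apply: H => x xs Qx; have [t [j ->]] := only _ xs Qx.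
  exact: gadget_rad G _ _.
rewrite sumQ.
apply: le_trans (_ : \sum_(j < m) (delta - (2 * rho + delta) * (e (a true j) + e (a false j))) <= _).
  rewrite sumrB -mulr_sumr -sumQ sumr_const card_ord -[delta *+ m]mulr_natl.
  have w0 : 0 <= 2 * rho + delta by lra.
  by have := ler_wpM2l w0 exits; lra.
apply: ler_sum => j _.
have stay x : val x >= - (2 * rho) * e x.
  by rewrite valE /e; case: (Q _) => /=; rewrite ?mulr1 ?mulr0; have := eucl_ge0 x (next s x); lra.
have sT := stay (a true j); have sF := stay (a false j).
have [eT|eT] := boolP (Q (next s (a true j))); last first.
  by move: sT sF; rewrite /e eT; case: (Q (next s (a false j))) => /=; lra.
have [eF|eF] := boolP (Q (next s (a false j))); last first.
  by move: sT sF; rewrite /e eT eF /=; lra.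
rewrite /val /e eT eF /= addr0 mulr0 subr0.
have far t : next s (a t j) \notin [:: a true j; a false j] -> Q (next s (a t j)) ->
    delta <= D (a t j) (next s (a t j)).
  move=> nt Qt; have [t' [j' E]] := only (next s (a t j)) ltac:(by rewrite mem_next) Qt.
  rewrite E; apply: sep; apply: contraNneq nt => jj'; rewrite E -jj' !inE.
  by case: t' {E}; rewrite eqxx ?orbT.
have [nT|nT] := boolP (next s (a true j) \in [:: a true j; a false j]); last first.
  by have := far _ nT eT; have := eucl_ge0 (a false j) (next s (a false j)); lra.
have [nF|nF] := boolP (next s (a false j) \in [:: a true j; a false j]); last first.
  by have := far _ nF eF; have := eucl_ge0 (a true j) (next s (a true j)); lra.
(* If both successors stay in the cluster, the whole tour does, although a second cluster exists. *)
pose C z := z \in [:: a true j; a false j].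
have /allP closed : all C s.
  apply: (@mem_next_closed _ _ _ (a true j)) => //; last by rewrite /C mem_head.
  by move=> y _; rewrite {1}/C !inE => /orP[]/eqP ->.
have [j' jj'] : exists j' : 'I_m, j' != j.
  have m0 : (0 < m)%N by apply: leq_trans m1.
  have [j0|j0] := eqVneq (j : nat) 0%N; first by exists (Ordinal m1); rewrite -val_eqE /= j0.
  by exists (Ordinal m0); rewrite -val_eqE /= eq_sym.
have := closed _ (mem_ true j'); rewrite /C !inE => /orP[]/eqP/inj[_ E];
  by rewrite E eqxx in jj'.
Qed.

(** * Contracting all gadgets at once *)

Section Gadgets.
Context {I : finType} {m : nat} (rho delta eps r : R) (s : seq (d.-tuple R)).
Context (S : {set I}) (Q : I -> pred (d.-tuple R)) (c : I -> d.-tuple R).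
Context (a : I -> bool -> 'I_m -> d.-tuple R).
Hypothesis (Us : uniq s) (opt : optimal s) (m1 : (1 < m)%N).
Hypothesis (rho0 : 0 <= rho) (delta0 : 0 <= delta) (r0 : 0 < r) (rr : 16 * rho < r).
Hypothesis (gad : forall i, i \in S -> gadget rho delta eps r s (Q i) (c i) (a i)).
Hypothesis (Qdisj : forall i j x, Q i x -> Q j x -> i = j).

Definition label x := [pick i in S | Q i x].
Definition contract x := if label x is Some i then c i else x.

Lemma labelP x i : reflect (i \in S /\ Q i x) (label x == Some i).
Proof.
rewrite /label; case: pickP => [j /andP[jS Qj]|none]; apply: (iffP eqP).
- by move=> [<-].
- by move=> [iS Qi]; congr Some; apply: Qdisj Qj Qi.
- by [].
- by move=> [iS Qi]; have := none i; rewrite iS Qi.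
Qed.

Lemma label_rad x i : x \in s -> label x = Some i -> D (c i) x <= rho.
Proof.
move=> xs /eqP/labelP[iS Qi].
have [t [j ->]] := gadget_only (gad iS) xs Qi.
exact: gadget_rad (gad iS) _ _.
Qed.

(** Contraction erases the edges inside a gadget and lengthens a crossing edge by at most [rho] at
    each end lying in a gadget. The potential [rho * g] moves the charge for entering a gadget to
    the edge leaving it, so that only exits are charged, [2 * rho] each. *)
Lemma contract_gain :
  \sum_(x <- s) D (contract x) (contract (next s x)) +
    #|S|%:R * (m%:R * delta - 2 * (2 * rho + delta)) <= clen D s.
Proof.
pose g x : R := (isSome (label x))%:R.
pose val x y : R := if isSome (label x) then
   if label x == label y then D x y else - (2 * rho) else 0.
have pointwise x y : x \in s -> y \in s ->
    D (contract x) (contract y) + val x y + rho * (g x - g y) <= D x y.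
  move=> xs ys; rewrite /val /g /contract.
  case Ex : (label x) => [i|]; case Ey : (label y) => [j|] /=.
  - have [[<-]|ij] := eqVneq; first by rewrite euclxx; lra.
    have := label_rad xs Ex; have := label_rad ys Ey.
    have := eucl_tri (c i) x (c j); have := eucl_tri x y (c j).
    by rewrite (euclC y); lra.
  - by have := label_rad xs Ex; have := eucl_tri (c i) x y; lra.
  - have := label_rad ys Ey; have := eucl_tri x y (c j).
    by rewrite (euclC y); lra.
  - by lra.
have sumval : #|S|%:R * (m%:R * delta - 2 * (2 * rho + delta)) <=
    \sum_(x <- s) val x (next s x).
  rewrite mulr_natl -sumr_const.
  apply: le_trans (_ : \sum_(i in S) \sum_(x <- s | Q i x)
     (if Q i (next s x) then D x (next s x) else - (2 * rho)) <= _).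
    by apply: ler_sum => i iS; apply: gadget_gain (gad iS) _ _ _ _ _ _ _.
  under eq_bigr do rewrite big_mkcond.
  rewrite exchange_big /= le_eqVlt; apply/orP; left; apply/eqP.
  apply: eq_bigr => x _; rewrite /val.
  case Ex : (label x) => [i|] /=.
    have /labelP[iS Qi] : label x == Some i by rewrite Ex.
    rewrite (bigD1 i) //= Qi big1 ?addr0 => [|k /andP[kS ki]]; last first.
      by case: ifP => // Qk; rewrite (Qdisj Qk Qi) eqxx in ki.
    by rewrite eq_sym; case: labelP => [[_ ->]//|H]; case: ifP => // Qn; case: H.
  apply: big1 => i iS; case: ifP => // Qi.
  by have /labelP/eqP : i \in S /\ Q i x by []; rewrite Ex.
rewrite clen_next //.
apply: le_trans (_ : \sum_(x <- s) (D (contract x) (contract (next s x)) +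
   val x (next s x) + rho * (g x - g (next s x))) <= _).
  rewrite !big_split /= -mulr_sumr sumrB sum_next // subrr mulr0 addr0.
  by rewrite lerD2l.
by rewrite [leLHS]big_seq [leRHS]big_seq; apply: ler_sum => x xs;
  apply: pointwise; rewrite ?mem_next.
Qed.

End Gadgets.
End Tour.

(** * Tours and matchings *)

Section Functionals.
Context {R : realType} {d : nat}.
Implicit Types (X : {fset d.-tuple R}) (s : seq (d.-tuple R)).
Local Notation D := (@eucl_dist R d).

Lemma perm_endpoints_cat (m1 m2 : seq (d.-tuple R * d.-tuple R)) :
  perm_eq (endpoints (m1 ++ m2)) (endpoints m1 ++ endpoints m2).
Proof.
apply/permP => P; rewrite /endpoints /unzip1 /unzip2 !map_cat !count_cat; lia.
Qed.

Lemma card_fset_perm X s : uniq s -> X =i s -> #|` X| = size s.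
Proof.
by move=> Us Xs; apply: perm_size; apply: uniq_perm; rewrite ?fset_uniq.
Qed.

(** [endpoints E] has even size, so [X] and [s] have the same parity, and the vertex that [pairs s]
    may leave out is exactly the one that is allowed. *)
Lemma is_matching_pairs X s (E : seq (d.-tuple R * d.-tuple R)) :
  uniq (s ++ endpoints E) -> s ++ endpoints E =i X ->
  is_matching X (pairs s ++ E).
Proof.
move=> Us sX; have [r Pr sr] := perm_pairs s.
have P : perm_eq (s ++ endpoints E) (endpoints (pairs s ++ E) ++ r).
  rewrite catA -/(endpoints _) in Pr; apply/permP => Q.
  have /permP/(_ Q) := Pr; have /permP/(_ Q) := perm_endpoints_cat (pairs s) E.
  by rewrite !count_cat; lia.
have := Us; rewrite (perm_uniq P) cat_uniq => /and3P[U1 /hasPn U2 U3].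
have cardX : #|` X| = size (s ++ endpoints E) by apply: card_fset_perm.
split=> //.
  by move=> x xe; rewrite -sX (perm_mem P) mem_cat xe.
rewrite cardX size_cat /endpoints size_cat !size_map addnn oddD odd_double addbF -sr.
apply: card_fset_perm => // x; rewrite !inE /=.
rewrite -sX (perm_mem P) mem_cat; case: (boolP (x \in r)) => [/U2 /= ->|_]; first by rewrite orbT.
by rewrite orbF andbN.
Qed.

Lemma matching_length_cat (m1 m2 : seq (d.-tuple R * d.-tuple R)) :
  matching_length (m1 ++ m2) = matching_length m1 + matching_length m2.
Proof. by rewrite /matching_length big_cat. Qed.

Lemma MM_le X m : is_matching X m -> MM X <= matching_length m.
Proof.
move=> Xm; apply: ge_inf; last by exists m.
by exists 0 => _ [m' _ <-]; apply: sumr_ge0 => e _; apply: eucl_ge0.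
Qed.

(* Alternate edges of a closed tour form two matchings, each missing at most
   one vertex. *)
Lemma double_MM_le X s (E : seq (d.-tuple R * d.-tuple R)) :
  uniq (s ++ endpoints E) -> s ++ endpoints E =i X ->
  2 * MM X <= clen D s + 2 * matching_length E.
Proof.
move=> Us sX; have := MM_le (is_matching_pairs Us sX).
have Pr : perm_eq (rot 1 s ++ endpoints E) (s ++ endpoints E).
  by rewrite perm_cat2r perm_rot.
have := @MM_le X (pairs (rot 1 s) ++ E).
rewrite !matching_length_cat => H.
have := is_matching_pairs (s := rot 1 s) (E := E).
rewrite (perm_uniq Pr) => /(_ X Us (fun x => etrans (perm_mem Pr x) (sX x)))/H.
have := sum_pairs_clen s (@eucl_ge0 R d); rewrite /matching_length; lra.
Qed.

(** The tours of [X] are its finitely many orderings, so some tour is optimal, and its length is a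
    lower bound for all of them. *)
Lemma TSP_ge X (l : R) :
  (forall s, uniq s -> s =i X -> optimal s -> l <= clen D s) -> l <= TSP X.
Proof.
move=> H; have Ux : uniq X by apply: fset_uniq.
have [s0] : exists2 s, s \in permutations X & forall t, t \in permutations X -> clen D s <= clen D t.
  by apply: (@seq_argmin _ _ _ _ (X : seq _)); rewrite mem_permutations.
rewrite mem_permutations => Ps0 min0.
have opt : optimal s0.
  by move=> s Ps; apply: min0; rewrite mem_permutations (perm_trans Ps).
have U0 : uniq s0 by rewrite (perm_uniq Ps0).
apply: lb_le_inf.
  by exists (tour_length s0), s0 => //; split => //; apply: perm_mem.
move=> _ [s [Us sX] <-]; rewrite /tour_length -(clen_next D Us).
apply: le_trans (H s0 U0 _ opt) (opt _ _); first exact: perm_mem.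
by apply: uniq_perm => // x; rewrite sX (perm_mem Ps0).
Qed.

(** The contracted tour, shortened to the points outside all gadgets, yields two matchings.
    Completing both by the cluster pairs costs [2 * m * eps] per gadget, to be subtracted from the
    gain of [contract_gain]. *)
Lemma gadgets_separate (I : finType) (m : nat) (rho delta eps r : R) X
    (S : {set I}) (Q : I -> pred (d.-tuple R)) (c : I -> d.-tuple R)
    (a : I -> bool -> 'I_m -> d.-tuple R) :
  (1 < m)%N -> 0 <= rho -> 0 <= delta -> 0 < r -> 16 * rho < r ->
  (forall i, i \in S -> gadget rho delta eps r X (Q i) (c i) (a i)) ->
  (forall i j x, Q i x -> Q j x -> i = j) ->
  2 * MM X + #|S|%:R * (m%:R * (delta - 2 * eps) - 2 * (2 * rho + delta)) <= TSP X.
Proof.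
move=> m1 rho0 delta0 r0 rr gX Qdisj; apply: TSP_ge => s Us sX opt.
have gad i : i \in S -> gadget rho delta eps r s (Q i) (c i) (a i).
  move=> /gX[h1 h2 h3 h4 h5 h6 h7 h8]; split=> //.
  - by move=> t j; rewrite sX.
  - by move=> x; rewrite sX; apply: h4.
  - by move=> x; rewrite sX; apply: h8.
have gain := contract_gain Us opt m1 rho0 delta0 r0 rr gad Qdisj.
pose G x := isSome (label S Q x).
have hG x : ~~ G x -> contract S Q c x = x by rewrite /G /contract; case: label.
have [s' Ps' Ls'] := clen_filter_contract (@eucl_ge0 R d) (@eucl_tri R d) hG Us.
(* The endpoints of these cluster pairs are exactly the points deleted from the tour. *)
pose E := [seq (a p.1 true p.2, a p.1 false p.2) | p : I * 'I_m <- enum {: I * 'I_m} & p.1 \in S].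
have lenE : matching_length E <= #|S|%:R * (m%:R * eps).
  rewrite /matching_length big_map big_filter big_enum_cond /=.
  rewrite (eq_bigl (fun p : I * 'I_m => (p.1 \in S) && true)); last by move=> p; rewrite andbT.
  rewrite -(pair_big (mem S) xpredT (fun i j => D (a i true j) (a i false j))) /=.
  apply: le_trans (_ : \sum_(i in S) \sum_(j < m) eps <= _); last first.
    by rewrite !sumr_const card_ord !mulr_natl.
  by apply: ler_sum => i iS; apply: ler_sum => j _; apply: gadget_pair (gad i iS) _.
have inE1 x : (x \in endpoints E) = (x \in s) && G x.
  rewrite mem_cat; apply/orP/andP.
    move=> H; have [i [t [j [iS ->]]]] : exists i t j, i \in S /\ x = a i t j.
      case: H => /mapP[e /mapP[[i j] /=]]; rewrite mem_filter /= => /andP[iS _] -> -> /=.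
        by exists i, true, j.
      by exists i, false, j.
    have /(labelP _ Qdisj)/eqP L : i \in S /\ Q i (a i t j).
      by split=> //; apply: gadget_in (gad i iS) _ _.
    by rewrite /G L (gadget_mem (gad i iS)).
  move=> [xs]; rewrite /G; case L : (label S Q x) => [i|] // _.
  have /(labelP _ Qdisj)[iS Qi] : label S Q x == Some i by rewrite L.
  have [t [j ->]] := gadget_only (gad i iS) xs Qi.
  have ijE : (a i true j, a i false j) \in E.
    by apply/mapP; exists (i, j) => //; rewrite mem_filter /= iS mem_enum.
  by case: t; [left|right]; apply: map_f ijE.
have UE : uniq (endpoints E).
  have inj t t' (p p' : I * 'I_m) : p.1 \in S -> p'.1 \in S ->
      a p.1 t p.2 = a p'.1 t' p'.2 -> t = t' /\ p = p'.
    move: p p' => [i j] [i' j'] /= iS iS' aa'.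
    have Qa := gadget_in (gad i iS) t j; rewrite aa' in Qa.
    have ii' := Qdisj _ _ _ Qa (gadget_in (gad i' iS') t' j').
    by subst i'; have [-> ->] := gadget_inj (gad i iS) aa'.
  have Ef : {in [seq p : I * 'I_m <- enum {: I * 'I_m} | p.1 \in S], forall p, p.1 \in S}.
    by move=> p; rewrite mem_filter => /andP[].
  have Uf : uniq [seq p : I * 'I_m <- enum {: I * 'I_m} | p.1 \in S].
    by rewrite filter_uniq // enum_uniq.
  rewrite /endpoints /unzip1 /unzip2 -!map_comp cat_uniq !map_inj_in_uniq ?Uf.
  - rewrite andbT /=; apply/hasPn => _ /mapP[p /Ef pS ->]; apply/mapP => -[p' /Ef pS'] /=.
    by move=> /(inj _ _ _ _ pS pS')[].
  - by move=> p p' /Ef pS /Ef pS' /(inj _ _ _ _ pS pS')[].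
  - by move=> p p' /Ef pS /Ef pS' /(inj _ _ _ _ pS pS')[].
have memS x : x \in s' = (x \in s) && ~~ G x by rewrite (perm_mem Ps') mem_filter andbC.
have UsE : uniq (s' ++ endpoints E).
  rewrite cat_uniq UE (perm_uniq Ps') filter_uniq // andbT /=.
  by apply/hasPn => x; rewrite inE1 /= memS => /andP[_ ->]; rewrite andbF.
have sEX : s' ++ endpoints E =i X.
  by move=> x; rewrite mem_cat inE1 memS -andb_orr orNb andbT sX.
have := double_MM_le UsE sEX; lra.
Qed.

End Functionals.

(** * The gadget of a cell *)

Definition box (R : realType) (d : nat) (A : 'I_d -> set R) : set (d.-tuple R) :=
  [set x | forall i, A i (tnth x i)].

Section Cells.
Context {R : realType} {d k M : nat}.
Hypothesis (hd : (2 <= d)%N) (k0 : (0 < k)%N).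
Implicit Types (Q : {ffun 'I_d -> 'I_k}) (t : bool) (j : 'I_16) (i : 'I_d).
Implicit Types (f : {ffun bool * 'I_16 -> 'I_M}) (y : nat -> d.-tuple R).
Local Notation D := (@eucl_dist R d).

(** Half-open intervals keep distinct cells disjoint. *)
Definition cell Q i : set R := `[(Q i)%:R / k%:R, ((Q i)%:R + 1) / k%:R[.

(* The spacing of the grid is [100 * unit_len / k], small enough for gadgets to
   be isolated, in the sense of the bound [16 * rho < r] of [count_exits]. *)
Definition unit_len : R := (128 * 128)^-1.

(** In units of [1 / k], the side of a tiny cube. Two points of a cluster differ by at most
    [d * tau + 2 * tau] in the sum norm, which is [unit_len]. *)
Definition tau : R := unit_len / (d%:R + 2).

(* The four by four grid of the clusters, in the first two coordinates. *)
Definition gpos j i : nat :=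
  if (i : nat) is 0 then (j %/ 4)%N else if (i : nat) is 1 then (j %% 4)%N else 0.

Definition gwid j i : R := (gpos j i)%:R * (100 * unit_len).

(* Keeps the two cubes of a cluster disjoint. *)
Definition shift t i : R := (t && (i == 0 :> nat))%:R * (2 * tau).

Definition corner Q t j i : R :=
  ((Q i)%:R + 2^-1 + gwid j i + shift t i)
    / k%:R.

Definition tiny Q t j i : set R := `[corner Q t j i, corner Q t j i + tau / k%:R].

(** The grid has three steps of [100 * unit_len] in each of two coordinates, so its middle is
    [150 * unit_len] from its corner. *)
Definition center Q : d.-tuple R :=
  [tuple ((Q i)%:R + 2^-1 + (i < 2)%:R * (150 * unit_len)) / k%:R | i < d].

(* The first [32 * M] points are cut into 32 blocks of [M] points, numbered by
   [enc], and [f] selects one point in each block. *)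
Definition dec (b : nat) : bool * 'I_16 := (odd b, inord b./2).
Definition enc t j : nat := t + (j : nat).*2.

Definition selected f (l : nat) : bool := (l %% M == f (dec (l %/ M)))%N.

Definition region Q f (l : nat) : set (d.-tuple R) :=
  if selected f l
  then box (tiny Q (dec (l %/ M)).1 (dec (l %/ M)).2) else ~` box (cell Q).

(** The place of each point is prescribed by its index alone, so that for the random sample this is
    an intersection of independent conditions. *)
Definition placed y Q f : Prop := forall l, (l < 32 * M)%N -> region Q f l (y l).

Definition pick_index f t j : nat := enc t j * M + f (t, j).

Lemma encK t j : dec (enc t j) = (t, j).
Proof.
rewrite /dec /enc oddD odd_double addbF oddb half_bit_double.
by congr pair; apply: val_inj; rewrite /= inordK.
Qed.

Lemma enc_lt t j : (enc t j < 32)%N.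
Proof. by rewrite /enc; have := ltn_ord j; case: t => /=; lia. Qed.

Lemma pick_index_lt f t j : (pick_index f t j < 32 * M)%N.
Proof.
have := enc_lt t j; have := ltn_ord (f (t, j)); rewrite /pick_index => H1 H2.
by apply: leq_trans (_ : (enc t j).+1 * M <= _)%N; rewrite ?leq_mul2r ?H2 ?orbT // mulSn addnC ltn_add2r.
Qed.

Lemma pick_index_div f t j : (pick_index f t j %/ M)%N = enc t j.
Proof.
have fM := ltn_ord (f (t, j)).
by rewrite /pick_index divnMDl ?divn_small ?addn0 //; apply: leq_ltn_trans fM.
Qed.

Lemma pick_index_mod f t j : (pick_index f t j %% M)%N = f (t, j).
Proof. by rewrite /pick_index modnMDl modn_small. Qed.

Lemma selectedP f l : (l < 32 * M)%N -> selected f l ->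
  l = pick_index f (dec (l %/ M)).1 (dec (l %/ M)).2.
Proof.
move=> lM /eqP E; rewrite /pick_index -surjective_pairing -E [LHS](divn_eq l M).
congr (_ * _ + _)%N; rewrite /enc /dec /= inordK.
  by rewrite odd_double_half.
have M0 : (0 < M)%N by case: (M) lM => //; rewrite muln0.
by rewrite ltn_half_double (_ : 16.*2 = 32)%N // ltn_divLR.
Qed.

Lemma placed_tiny y Q f t j : placed y Q f ->
  box (tiny Q t j) (y (pick_index f t j)).
Proof.
move/(_ _ (pick_index_lt f t j)); rewrite /region /selected pick_index_div encK.
by rewrite pick_index_mod eqxx.
Qed.

(** * Metric estimates for the tiny cubes *)

Lemma unit_gt0 : 0 < unit_len. Proof. by rewrite invr_gt0 mulr_gt0. Qed.

Lemma unit_eq : 128 * (128 * unit_len) = 1.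
Proof. by rewrite mulrA mulfV // mulf_neq0. Qed.

Let d2 : 0 < d%:R + 2 :> R. Proof. by rewrite ltr_wpDl. Qed.

Lemma tau_gt0 : 0 < tau. Proof. by rewrite divr_gt0 ?unit_gt0. Qed.

Lemma d_tau : (d%:R + 2) * tau = unit_len.
Proof. by rewrite mulrCA mulfV ?mulr1 // gt_eqF. Qed.

Lemma tau_le : 4 * tau <= unit_len.
Proof.
rewrite -d_tau ler_wpM2r ?(ltW tau_gt0) //.
have : (2 : R) <= d%:R by rewrite ler_nat.
lra.
Qed.

Let kR : 0 < k%:R :> R. Proof. by rewrite ltr0n. Qed.

Lemma gwid_bound j i : 0 <= gwid j i <= (i < 2)%:R * (300 * unit_len).
Proof.
have u0 : 0 <= 100 * unit_len by have := unit_gt0; lra.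
rewrite /gwid mulr_ge0 //=.
have : (gpos j i <= (i < 2) * 3)%N.
  by rewrite /gpos; have := ltn_ord j; case: (i : nat) => [|[|]] /=; lia.
by rewrite -(ler_nat R) natrM => /(ler_wpM2r u0); lra.
Qed.

Lemma shift_bound t i : 0 <= shift t i <= (i < 1)%:R * (2 * tau).
Proof.
by have := tau_gt0; rewrite /shift; case: t; case: (i : nat) => [|n] /=; lra.
Qed.

Lemma tiny_cell Q t j x : box (tiny Q t j) x -> box (cell Q) x.
Proof.
move=> tx i; have := tx i; rewrite /tiny /cell /= !in_itv /= /corner.
rewrite -mulrDl !(ler_pdivrMr _ _ kR) !(ler_pdivlMr _ _ kR) (ltr_pdivlMr _ _ kR).
have := unit_eq; have := unit_gt0; have := tau_gt0; have := tau_le.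
have := gwid_bound j i; have := shift_bound t i.
by case: (i < 2)%N; case: (i < 1)%N => /=; lra.
Qed.

Lemma eucl_l1_le (x y : d.-tuple R) (b : 'I_d -> R) :
  (forall i, `|tnth x i - tnth y i| <= b i) -> D x y <= \sum_(i < d) b i.
Proof. by move=> H; apply: le_trans (eucl_l1 x y) _; apply: ler_sum. Qed.

Lemma sum_ord_lt (m n : nat) : (\sum_(i < m) (i < n)%N)%N = minn m n.
Proof. by elim: m => [|m IH]; rewrite ?big_ord0 ?min0n // big_ord_recr /= IH; lia. Qed.

Lemma sum_profile (n : nat) (u v : R) : (n <= d)%N ->
  \sum_(i < d) ((i < n)%:R * u + v) / k%:R = (n%:R * u + d%:R * v) / k%:R.
Proof.
move=> nd; rewrite -mulr_suml big_split /= sumr_const card_ord -mulr_suml.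
by rewrite -natr_sum sum_ord_lt (minn_idPr nd) mulr_natl -[v *+ d]mulr_natl mulr_natl.
Qed.

(** The grid contributes [150 * unit_len] in each of two coordinates; the shifts and the cube sides
    add at most [(d + 4) * tau], less than [2 * unit_len]. *)
Lemma tiny_center Q t j x : box (tiny Q t j) x ->
  D (center Q) x <= (302 * unit_len) / k%:R.
Proof.
move=> tx.
apply: le_trans (_ : \sum_(i < d) ((i < 2)%:R * (150 * unit_len + 2 * tau) + tau) / k%:R <= _).
  apply: eucl_l1_le => i; have := tx i; rewrite /tiny /= in_itv /= /corner tnth_mktuple.
  rewrite -mulrDl (ler_pdivrMr _ _ kR) (ler_pdivlMr _ _ kR) ler_norml => H.
  rewrite -mulNr (ler_pdivrMr _ _ kR) (ler_pdivlMr _ _ kR) mulrBl divfK ?gt_eqF //.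
  move: H; have := tau_gt0; have := unit_gt0.
  have := gwid_bound j i; have := shift_bound t i.
  move: (tnth x i * _) => X; case: (ltnP i 1) => [i1|_] /=.
    by rewrite (ltn_trans i1) //=; lra.
  by case: (i < 2)%N => /=; lra.
rewrite sum_profile // ler_pM2r ?invr_gt0 //; have := d_tau; have := tau_le; have := unit_gt0; lra.
Qed.

(** Distinct clusters differ in a base-four digit, hence by a full grid step in one of the first two
    coordinates. Shift and side take away at most [3 * tau], less than [unit_len]. *)
Lemma tiny_sep Q t t' j j' (x y : d.-tuple R) : j != j' -> box (tiny Q t j) x -> box (tiny Q t' j') y ->
  (99 * unit_len) / k%:R <= D x y.
Proof.
move=> jj' xj yj'.
suff [i Hi] : exists i : 'I_d, gwid j i + 100 * unit_len <= gwid j' i \/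
    gwid j' i + 100 * unit_len <= gwid j i.
  apply: le_trans (eucl_coord x y i); have := xj i; have := yj' i.
  rewrite /tiny /= !in_itv /= /corner -!mulrDl !(ler_pdivrMr _ _ kR) !(ler_pdivlMr _ _ kR).
  rewrite -[X in `|_| * X](gtr0_norm kR) -normrM mulrBl => H1 H2.
  move: (tnth x i * _) (tnth y i * _) H1 H2 => X Y; have := tau_gt0; have := tau_le.
  have := shift_bound t i; have := shift_bound t' i.
  have : (i < 1)%:R * (2 * tau) <= 2 * tau by case: (i < 1)%N => /=; have := tau_gt0; lra.
  case: Hi => Hi sh s1 s2 t1 t0 H1 H2.
    by rewrite distrC; apply: le_trans (ler_norm _); lra.
  by apply: le_trans (ler_norm _); lra.
suff [i Hi] : exists i : 'I_d, (gpos j i < gpos j' i)%N \/ (gpos j' i < gpos j i)%N.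
  have u0 : 0 <= 100 * unit_len by have := unit_gt0; lra.
  have wid n n' : (n < n')%N -> n%:R * (100 * unit_len) + 100 * unit_len <= n'%:R * (100 * unit_len).
    by rewrite -(ler_nat R) -natr1 => /(ler_wpM2r u0); lra.
  by exists i; case: Hi => /wid; [left|right].
have d0 : (0 < d)%N by lia.
have [E|] := eqVneq (j %/ 4)%N (j' %/ 4)%N.
  exists (Ordinal hd); apply/orP; rewrite /gpos /= -neq_ltn; apply: contra jj' => /eqP E'.
  by apply/eqP/val_inj; rewrite /= (divn_eq j 4) (divn_eq j' 4) E E'.
by exists (Ordinal d0); apply/orP; rewrite /gpos /= -neq_ltn.
Qed.

Lemma tiny_pair Q t t' j (x y : d.-tuple R) : box (tiny Q t j) x -> box (tiny Q t' j) y ->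
  D x y <= unit_len / k%:R.
Proof.
move=> xj yj.
apply: le_trans (_ : \sum_(i < d) ((i < 1)%:R * (2 * tau) + tau) / k%:R <= _).
  apply: eucl_l1_le => i; have := xj i; have := yj i.
  rewrite /tiny /= !in_itv /= /corner -!mulrDl !(ler_pdivrMr _ _ kR) !(ler_pdivlMr _ _ kR).
  rewrite -[X in `|_| * X](gtr0_norm kR) -normrM mulrBl.
  move: (tnth x i * _) (tnth y i * _) => X Y; have := tau_gt0; have := shift_bound t i.
  have := shift_bound t' i; rewrite ler_norml; lra.
rewrite sum_profile; last by lia.
by rewrite ler_pM2r ?invr_gt0 //; have := d_tau; lra.
Qed.

Lemma tiny_neq Q j x : box (tiny Q true j) x -> box (tiny Q false j) x -> False.
Proof.
have d0 : (0 < d)%N by lia.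
move=> /(_ (Ordinal d0)) + /(_ (Ordinal d0)).
rewrite /tiny /= !in_itv /= /corner -!mulrDl !(ler_pdivrMr _ _ kR) !(ler_pdivlMr _ _ kR).
by have := tau_gt0; rewrite /shift /=; lra.
Qed.

(** In units of [1 / k], every coordinate of the centre is within [150 * unit_len], less than
    [1/10], of the middle of the cell, whose half side is [1/2]. *)
Lemma cell_far Q x : ~ box (cell Q) x -> (2 / 5) / k%:R <= D (center Q) x.
Proof.
move=> /existsNP[i /negP]; rewrite /cell /= in_itv /= => H.
apply: le_trans (eucl_coord _ x i); rewrite tnth_mktuple.
rewrite (ler_pdivrMr _ _ kR) -[X in `|_| * X](gtr0_norm kR) -normrM mulrBl divfK ?gt_eqF //.
have : 0 <= (i < 2)%:R * (150 * unit_len) <= 150 * unit_len.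
  by have := unit_gt0; case: (i < 2)%N => /=; lra.
move: H; rewrite (ler_pdivrMr _ _ kR) (ltr_pdivlMr _ _ kR) negb_and -ltNge -leNgt.
move: (tnth x i * _) (_ * (150 * unit_len)) => X e; have := unit_eq; have := unit_gt0.
move=> u0 u1 /orP[H|H] e0; first by apply: le_trans (ler_norm _); lra.
by rewrite distrC; apply: le_trans (ler_norm _); lra.
Qed.

Lemma cell_disjoint Q Q' x : box (cell Q) x -> box (cell Q') x -> Q = Q'.
Proof.
move=> Qx Qx'; apply/ffunP => i; apply: val_inj; move: (Qx i) (Qx' i).
rewrite /cell /= !in_itv /= !(ler_pdivrMr _ _ kR) !(ltr_pdivlMr _ _ kR) => /andP[h1 h2] /andP[h3 h4].
have : (Q i)%:R < ((Q' i).+1)%:R :> R by rewrite -natr1; lra.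
have : (Q' i)%:R < ((Q i).+1)%:R :> R by rewrite -natr1; lra.
by rewrite !ltr_nat; lia.
Qed.

Lemma placed_gadget y Q f : placed y Q f ->
  gadget ((302 * unit_len) / k%:R) ((99 * unit_len) / k%:R) (unit_len / k%:R)
    ((2 / 5) / k%:R) (first_points y (32 * M)) (fun x => `[< box (cell Q) x >])
    (center Q) (fun t j => y (pick_index f t j)).
Proof.
move=> yQ; have tin t j := placed_tiny t j yQ; split.
- move=> t j; rewrite /first_points /=; apply/imfsetP; exists (pick_index f t j) => //=.
  by rewrite mem_iota /= pick_index_lt.
- by move=> t j; apply/asboolP; apply: tiny_cell (tin t j).
- move=> t t' j j' E; have := tin t j; have := tin t' j'; rewrite -E => H1 H2.
  have [jj'|jj'] := eqVneq j j'; last first.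
    have := tiny_sep jj' H2 H1; rewrite euclxx leNgt divr_gt0 //; have := unit_gt0; lra.
  subst j'; split=> //; case: t t' {E} H1 H2 => -[] // H1 H2.
    by case: (tiny_neq H2 H1).
  by case: (tiny_neq H1 H2).
- move=> x /imfsetP[l /=]; rewrite mem_iota /= add0n => lM -> /asboolP xQ.
  have := yQ l lM; rewrite /region; case: ifP => // /(selectedP lM) E _.
  by exists (dec (l %/ M)).1, (dec (l %/ M)).2; rewrite -E.
- by move=> t j; apply: tiny_center (tin t j).
- by move=> t t' j j' jj'; apply: tiny_sep jj' (tin t j) (tin t' j').
- by move=> j; apply: tiny_pair (tin true j) (tin false j).
- by move=> x _ /asboolP; apply: cell_far.
Qed.

(** A point selected by [f] lies in the cell, where [f'] admits only the points that it selects
    itself. Hence the sum over [f] of the indicators of [placed] is 0 or 1. *)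
Lemma placed_inj y Q f f' : placed y Q f -> placed y Q f' -> f = f'.
Proof.
move=> yf yf'; apply/ffunP => -[t j]; apply: val_inj; apply/eqP.
have xQ := tiny_cell (placed_tiny t j yf).
have := yf' _ (pick_index_lt f t j); rewrite /region; case: ifP => // H _.
by move: H; rewrite /selected pick_index_div encK pick_index_mod.
Qed.

(** The double sum counts the cells that hold a gadget. With 16 clusters, each gains
    [16 * (99 - 2) - 2 * (2 * 302 + 99) = 146] times [unit_len / k]. *)
Lemma placed_gain y : (0 < M)%N ->
  2 * MM (first_points y (32 * M)) +
    (146 * unit_len) / k%:R * \sum_Q \sum_f (`[< placed y Q f >])%:R <=
  TSP (first_points y (32 * M)).
Proof.
move=> M0; pose S := [set Q | [exists f, `[< placed y Q f >]]]%SET.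
(* A default that [F] never takes on [S]. *)
pose f0 : {ffun bool * 'I_16 -> 'I_M} := [ffun=> Ordinal M0].
pose F Q := odflt f0 [pick f | `[< placed y Q f >]].
have FP Q : Q \in S -> placed y Q (F Q).
  rewrite inE /F => /existsP[f yf]; case: pickP => [f' /asboolP//|/(_ f)].
  by rewrite yf.
have -> : \sum_Q \sum_f (`[< placed y Q f >])%:R = #|S|%:R :> R.
  rewrite -sumr_const [RHS]big_mkcond /=; apply: eq_bigr => Q _.
  case: ifPn => [QS|].
    rewrite (bigD1 (F Q)) //= asboolT; last exact: FP.
    rewrite big1 ?addr0 // => f fF; case: asboolP => // yf.
    by rewrite (placed_inj yf (FP Q QS)) eqxx in fF.
  rewrite inE negb_exists => /forallP H; apply: big1 => f _.
  by rewrite (negbTE (H f)).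
have k'0 : 0 < (k%:R : R)^-1 by rewrite invr_gt0.
have := @gadgets_separate R d _ 16 ((302 * unit_len) / k%:R) ((99 * unit_len) / k%:R) (unit_len / k%:R)
    ((2 / 5) / k%:R) (first_points y (32 * M)) S (fun Q x => `[< box (cell Q) x >])
    center (fun Q t j => y (pick_index (F Q) t j)).
have u0 := unit_gt0; have u1 := unit_eq.
set kk := k%:R^-1 in k'0 *.
have ukk : 0 < unit_len * kk by rewrite mulr_gt0.
have gad Q : Q \in S -> gadget _ _ _ _ _ _ _ _ := fun QS => placed_gadget (FP Q QS).
have dis Q Q' x : `[< box (cell Q) x >] -> `[< box (cell Q') x >] -> Q = Q'.
  by move=> /asboolP Qx /asboolP; apply: cell_disjoint.
move=> /(_ isT _ _ _ _ gad dis) H; apply: le_trans (H _ _ _ _); last 1 first.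
- by rewrite mulrA ltr_pM2r //; lra.
- rewrite lerD2l [leLHS]mulrC ler_wpM2l //; lra.
- by rewrite -mulrA; lra.
- by rewrite -mulrA; lra.
- by rewrite mulr_gt0.
Qed.

End Cells.

(** * Probability of a gadget *)

Lemma uniform_prob_itv (R : realType) (a b : R) (u v : bool) :
  0 <= a -> a <= b -> b <= 1 ->
  uniform_prob (@ltr01 R) [set` Interval (BSide u a) (BSide v b)] = (b - a)%:E.
Proof.
move=> a0 ab b1; set U := [set` _].
have mU : measurable U by apply: measurable_itv.
have UE : U `&` `[0, 1] = U.
  apply/seteqP; split=> [y []//|y Uy]; split=> //.
  move: Uy; rewrite /U /= !itv_boundlr /= => /andP[ya yb].
  apply/andP; split; rewrite bnd_simp.
    apply: le_trans a0 _; move: ya; case: (u) => /=; rewrite bnd_simp // => /ltW.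
    by [].
  apply: le_trans b1; move: yb; case: (v) => /=; rewrite bnd_simp // => /ltW.
  by [].
rewrite /uniform_prob integral_uniform_pdf UE.
rewrite (eq_integral (cst 1%E)).
  rewrite integral_cst // mul1e -[LHS]/(lebesgue_measure U) /U lebesgue_measure_itv /= lte_fin.
  by case: ltP => //; move/(conj ab)/andP/le_anti => ->; rewrite subrr.
move=> y; rewrite inE => Uy; have : (U `&` `[0, 1]) y by rewrite UE.
by move=> [_ /=]; rewrite in_itv /uniform_pdf /= => ->; rewrite subr0 invr1.
Qed.

Section Probability.
Context (R : realType) (d : nat) (dT : measure_display) (T : measurableType dT).
Context (P : probability T R) (x : nat -> {RV P >-> d.-tuple R}).
Hypothesis (hind : mutually_independent x).
Hypothesis (hunif : forall i : nat, uniform_on_cube (x i)).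

Lemma measurable_box (A : 'I_d -> set R) :
  (forall i, measurable (A i)) -> measurable (box A).
Proof.
move=> mA; rewrite (_ : box A = \bigcap_(i in setT) ((@tnth d R ^~ i) @^-1` A i)).
  apply: fin_bigcap_measurable => // i _; rewrite -[X in measurable X]setTI.
  exact: measurable_tnth.
by apply/seteqP; split=> [y yA i _|y yA i]; apply: yA.
Qed.

Lemma prob_box l (A : 'I_d -> set R) (p : R) :
  (forall i, measurable (A i)) ->
  (forall i, uniform_prob (@ltr01 R) (A i) = p%:E) ->
  P (x l @^-1` box A) = (p ^+ d)%:E.
Proof.
move=> mA pA; have := hunif l mA; rewrite /distribution /pushforward => ->.
by rewrite (eq_bigr (fun=> p%:E)) // prodEFin prodr_const card_ord.
Qed.

Section Cells.
Context {k M : nat}.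
Hypothesis (hd : (2 <= d)%N) (k0 : (0 < k)%N) (M0 : (0 < M)%N) (kM : (k ^ d = 2 * M)%N).
Implicit Types (Q : {ffun 'I_d -> 'I_k}) (f : {ffun bool * 'I_16 -> 'I_M}).

Let kR : 0 < k%:R :> R. Proof. by rewrite ltr0n. Qed.

Lemma measurable_cell Q i : measurable (cell (R := R) Q i).
Proof. exact: measurable_itv. Qed.

Lemma measurable_tiny Q t j i : measurable (tiny (R := R) Q t j i).
Proof. exact: measurable_itv. Qed.

Lemma measurable_region Q f l : measurable (region (R := R) Q f l).
Proof.
rewrite /region; case: ifP => _.
  by apply: measurable_box => i; apply: measurable_tiny.
by apply: measurableC; apply: measurable_box => i; apply: measurable_cell.
Qed.

Lemma cell_bounds Q (i : 'I_d) : 0 <= (Q i)%:R / k%:R :> R /\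
  ((Q i)%:R + 1) / k%:R <= 1 :> R.
Proof.
split; first by rewrite divr_ge0.
by rewrite ler_pdivrMr // mul1r natr1 ler_nat.
Qed.

Lemma prob_cell Q l : P (x l @^-1` box (cell Q)) = ((k%:R^-1) ^+ d)%:E.
Proof.
apply: prob_box => i; first exact: measurable_cell.
have [c0 c1] := cell_bounds Q i.
rewrite uniform_prob_itv //; last by rewrite ler_pM2r ?invr_gt0 // lerDl.
by rewrite -mulrBl addrAC subrr add0r mul1r.
Qed.

Lemma prob_tiny Q t j l : P (x l @^-1` box (tiny Q t j)) = ((tau (R:=R) (d:=d) / k%:R) ^+ d)%:E.
Proof.
apply: prob_box => i; first exact: measurable_tiny.
have [c0 c1] := cell_bounds Q i; have t0 := @tau_gt0 R d.
have u1 := @unit_eq R; have u2 := @unit_gt0 R; have u3 := @tau_le R _ hd.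
rewrite uniform_prob_itv.
- by rewrite addrAC subrr add0r.
- apply: le_trans c0 _; rewrite ler_pM2r ?invr_gt0 //.
  have := gwid_bound (R := R) hd k0 j i; have := shift_bound (R := R) t i.
  by lra.
- by rewrite lerDl divr_ge0 // ltW.
- apply: le_trans c1; rewrite -mulrDl ler_pM2r ?invr_gt0 //.
  have := gwid_bound (R := R) hd k0 j i; have := shift_bound (R := R) t i.
  by case: (i < 2)%N; case: (i < 1)%N => /=; lra.
Qed.

Definition event Q f : set T := [set w | placed (fun l => x l w) Q f].

Lemma eventE Q f :
  event Q f = \bigcap_(l in [set` [fset l in iota 0 (32 * M)]%fset]) (x l @^-1` region Q f l).
Proof.
apply/seteqP; split=> w /= H l.
  by rewrite /= !inE mem_iota /= => lM; apply: H.
by move=> lM; apply: H; rewrite /= !inE mem_iota.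
Qed.

Lemma measurable_event Q f : measurable (event Q f).
Proof.
rewrite eventE; apply: fin_bigcap_measurable; first exact: finite_fset.
move=> l _; rewrite -[X in measurable X]setTI; apply: measurable_funP => //.
exact: measurable_region.
Qed.

(** The probability for one block: the selected point hits its tiny cube and the other [M - 1]
    points miss the cell. *)
Definition event_prob : R := (tau (R:=R) (d:=d) / k%:R) ^+ d * (1 - (k%:R^-1) ^+ d) ^+ M.-1.

Lemma prob_event Q f : P (event Q f) = (event_prob ^+ 32)%:E.
Proof.
rewrite eventE hind; last by move=> l _; apply: measurable_region.
pose F l : R := if selected f l then (tau (R:=R) (d:=d) / k%:R) ^+ d else 1 - (k%:R^-1) ^+ d.
rewrite (eq_bigr (fun l => (F l)%:E)); last first.
  move=> l _; rewrite /F /region; case: ifP => _; first exact: prob_tiny.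
  rewrite -[x l @^-1` _]/(~` (x l @^-1` box (cell Q))) probability_setC ?prob_cell //.
  rewrite -[X in measurable X]setTI; apply: measurable_funP => //.
  by apply: measurable_box => i; apply: measurable_cell.
rewrite prodEFin (perm_big (iota 0 (32 * M))) /=; last first.
  by apply: uniq_perm; rewrite ?fset_uniq ?iota_uniq // => l; rewrite !inE.
(* The product is cut into 32 blocks of [M] factors, each with exactly one selected index. *)
rewrite -[X in iota 0 X]subn0 -/(index_iota 0 (32 * M)) big_nat_mul.
rewrite -[in RHS](card_ord 32) -prodr_const big_mkord; congr EFin.
apply: eq_bigr => b _; rewrite -{1}[(b * M)%N]add0n big_addn mulSn addnK big_mkord.
rewrite (bigD1 (f (dec b))) //= (eq_bigr (fun=> 1 - (k%:R^-1) ^+ d)).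
  rewrite prodr_const /F /selected addnC divnMDl // modnMDl divn_small // addn0 modn_small //.
  rewrite eqxx; congr (_ * _ ^+ _).
  by rewrite (cardC1 (f (dec b))) card_ord.
move=> l lf; rewrite /F /selected addnC divnMDl // modnMDl divn_small // addn0 modn_small //.
by rewrite ifN.
Qed.

End Cells.
End Probability.

(** * Gain in the limit *)

Lemma bernoulli_le (R : realFieldType) (x : R) n :
  0 <= x <= 1 -> 1 - n%:R * x <= (1 - x) ^+ n.
Proof.
move=> /andP[x0 x1]; elim: n => [|n IH]; first by rewrite mul0r subr0 expr0.
have := mulr_ge0 (ler0n R n) (mulr_ge0 x0 x0).
have x1' : 0 <= 1 - x by lra.
by rewrite exprS -natr1; have := ler_wpM2l x1' IH; lra.
Qed.

Section Limit.
Context (R : realType) (d : nat) (dT : measure_display) (T : measurableType dT).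
Context (P : probability T R) (x : nat -> {RV P >-> d.-tuple R}).
Hypothesis (hind : mutually_independent x).
Hypothesis (hunif : forall i : nat, uniform_on_cube (x i)).
Hypothesis (hd : (2 <= d)%N).

(** The proportion of cells that hold a gadget: by [placed_inj] at most one [f] counts for each
    cell. *)
Definition good_fraction (k M : nat) (w : T) : R :=
  (k%:R ^+ d)^-1 * \sum_(Q : {ffun 'I_d -> 'I_k})
    \sum_(f : {ffun bool * 'I_16 -> 'I_M}) \1_(event x Q f) w.

Section Size.
Context {k M : nat}.
Hypothesis (k0 : (0 < k)%N) (M0 : (0 < M)%N) (kM : (k ^ d = 2 * M)%N).

Let kd : k%:R ^+ d = 2 * M%:R :> R.
Proof. by rewrite -natrX kM natrM. Qed.

Let kR : 0 < k%:R :> R. Proof. by rewrite ltr0n. Qed.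

Let MR : 0 < M%:R :> R. Proof. by rewrite ltr0n. Qed.

Lemma indic_event (Q : {ffun 'I_d -> 'I_k}) (f : {ffun bool * 'I_16 -> 'I_M}) w :
  \1_(event x Q f) w = (`[< placed (fun l => x l w) Q f >])%:R :> R.
Proof. by rewrite indicE; congr (nat_of_bool _)%:R; apply/idP/asboolP; rewrite inE. Qed.

Lemma good_fraction_ge0 w : 0 <= good_fraction k M w.
Proof.
rewrite mulr_ge0 ?invr_ge0 ?exprn_ge0 //.
by apply: sumr_ge0 => Q _; apply: sumr_ge0 => f _; rewrite indicE.
Qed.

Lemma good_fraction_le1 w : good_fraction k M w <= 1.
Proof.
rewrite ler_pdivrMl ?exprn_gt0 // mulr1 -natrX.
have -> : (k ^ d)%:R = \sum_(Q : {ffun 'I_d -> 'I_k}) 1 :> R.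
  by rewrite sumr_const card_ffun !card_ord.
apply: ler_sum => Q _; under eq_bigr do rewrite indic_event.
have [[f yf]|none] := pselect (exists f : {ffun bool * 'I_16 -> 'I_M}, placed (fun l => x l w) Q f).
  rewrite (bigD1 f) //= big1 ?addr0 ?asboolT // => f' ff'.
  by case: asboolP => // yf'; rewrite (placed_inj hd k0 yf yf') eqxx in ff'.
rewrite big1 // => f _; case: asboolP => // yf.
by case: none; exists f.
Qed.

Lemma measurable_good_fraction : measurable_fun setT (good_fraction k M).
Proof.
apply: measurable_funM => //; apply: measurable_sum => Q.
by apply: measurable_sum => f; apply: measurable_indic; apply: measurable_event.
Qed.

(** There are [k ^ d] cells and [M ^ 32] choices of [f], so the expectation is the 32nd power of
    [M * event_prob]. As [M / k ^ d = 1/2], this base is at least [tau ^ d / 4], whatever [k] is. *)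
Lemma expected_good_fraction :
  (((tau (R:=R) (d:=d) ^+ d / 4) ^+ 32)%:E <= \int[P]_w (good_fraction k M w)%:E)%E.
Proof.
rewrite /good_fraction.
under eq_integral do rewrite EFinM.
rewrite ge0_integralZl //; last 2 first.
- apply/measurable_EFinP; apply: measurable_sum => Q.
  by apply: measurable_sum => f; apply: measurable_indic; apply: measurable_event.
- move=> w _; rewrite lee_fin.
  by apply: sumr_ge0 => Q _; apply: sumr_ge0 => f _; rewrite indicE.
have -> : (\int[P]_w (\sum_(Q : {ffun 'I_d -> 'I_k})
    \sum_(f : {ffun bool * 'I_16 -> 'I_M}) \1_(event x Q f) w)%:E =
    (\sum_(p : {ffun 'I_d -> 'I_k} * {ffun bool * 'I_16 -> 'I_M}) event_prob R d (k:=k) (M:=M) ^+ 32)%:E)%E.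
  under eq_integral do rewrite pair_bigA /= -sumEFin.
  rewrite ge0_integral_sum //.
  - rewrite -sumEFin; apply: eq_bigr => p _.
    rewrite integral_indic //; last exact: measurable_event.
    by rewrite setIT; apply: prob_event.
  - by move=> p; apply/measurable_EFinP; apply: measurable_indic; apply: measurable_event.
rewrite sumr_const -EFinM lee_fin.
rewrite -[#|_|]/#|{: _ * _}| card_prod !card_ffun card_prod !card_ord card_bool.
rewrite -[_ *+ (_ * _)]mulr_natl natrM !natrX -mulrA mulKf ?gt_eqF ?exprn_gt0 //.
rewrite (_ : 2 * 16 = 32)%N // -exprMn.
have t0 : 0 <= tau (R := R) (d := d) ^+ d by rewrite exprn_ge0 // ltW // tau_gt0.
(* Bernoulli's inequality, with [M - 1] factors that each fall short of 1 by [1 / (2 * M)]. *)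
have half : 2^-1 <= (1 - (k%:R^-1) ^+ d) ^+ M.-1 :> R.
  rewrite exprVn kd; apply: le_trans (bernoulli_le _ _); last first.
    have M1 : (1 : R) <= M%:R by rewrite ler1n.
    rewrite invr_ge0 mulr_ge0 //= invf_le1 ?mulr_gt0 //; lra.
  have : (M.-1)%:R <= M%:R :> R by rewrite ler_nat leq_pred.
  rewrite -(ler_pM2r (x := (2 * M%:R)^-1)) ?invr_gt0 ?mulr_gt0 //.
  have -> : M%:R * (2 * M%:R)^-1 = 2^-1 :> R by field; rewrite gt_eqF.
  by lra.
apply: lerXn2r; rewrite ?nnegrE.
- by rewrite divr_ge0.
- rewrite !mulr_ge0 //; apply: exprn_ge0.
    by rewrite divr_ge0 // ltW // tau_gt0.
  rewrite exprVn kd subr_ge0 invf_le1 ?mulr_gt0 //.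
  by rewrite -natrM ler1n muln_gt0 M0.
rewrite /event_prob exprVn -[(tau / k%:R) ^+ d]/((_ * k%:R^-1) ^+ d) [(tau / _) ^+ d]exprMn exprVn kd.
have -> : M%:R * (tau (R:=R) (d:=d) ^+ d * (2 * M%:R)^-1 * (1 - (2 * M%:R)^-1) ^+ M.-1) =
   tau (R:=R) (d:=d) ^+ d * ((1 - (2 * M%:R)^-1) ^+ M.-1 / 2).
  by field; rewrite gt_eqF.
by rewrite ler_wpM2l //; rewrite exprVn kd in half; lra.
Qed.

(** Since [n = 16 * k ^ d], the normalisation is a constant times [k ^ (d - 1)]. A proportion of
    [k ^ d] cells, each gaining a constant over [k], has the same order. *)
Lemma good_fraction_gain w n : n = (32 * M)%N ->
  146 * unit_len (R := R) / 16 `^ ((d%:R - 1) / d%:R) * good_fraction k M w <=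
  TSP (first_points (fun l => x l w) n) / n%:R `^ ((d%:R - 1) / d%:R) -
  2 * (MM (first_points (fun l => x l w) n) / n%:R `^ ((d%:R - 1) / d%:R)).
Proof.
move=> nM; set al := (d%:R - 1) / d%:R.
have nE : n%:R `^ al = 16 `^ al * k%:R ^+ d.-1 :> R.
  have -> : n%:R = 16 * k%:R ^+ d :> R by rewrite kd nM natrM; ring.
  rewrite powRM ?exprn_ge0 //; congr (_ * _).
  rewrite -powR_mulrn // -powRrM /al mulrCA mulfV ?mulr1; last by rewrite pnatr_eq0; lia.
  by rewrite -powR_mulrn //; congr (_ `^ _); rewrite -subn1 natrB //; lia.
have n0 : 0 < n%:R `^ al :> R by rewrite powR_gt0 // ltr0n nM; lia.
rewrite mulrA -mulrBl ler_pdivlMr //.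
have := placed_gain (R := R) hd k0 (fun l => x l w) M0; rewrite -nM.
rewrite -lerBrDl; apply: le_trans.
rewrite /good_fraction nE; under eq_bigr do under eq_bigr do rewrite indic_event.
set s := \sum_(Q : {ffun 'I_d -> 'I_k}) _; set a := 16 `^ al.
have a0 : 0 < a by rewrite powR_gt0.
have -> : k%:R ^+ d = k%:R * k%:R ^+ d.-1 :> R by rewrite -exprS prednK //; lia.
set b := k%:R ^+ d.-1; have b0 : 0 < b by rewrite exprn_gt0.
rewrite le_eqVlt; apply/orP; left; apply/eqP; field.
by rewrite !gt_eqF.
Qed.

End Size.
End Limit.

(** * Conclusion by dominated convergence along a subsequence *)

Theorem theorem1p5 (R : realType) (d : nat) (hd : (2 <= d)%N)
    (dT : measure_display) (T : measurableType dT) (P : probability T R)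
    (x : nat -> {RV P >-> d.-tuple R})
    (hind : mutually_independent x)
    (hunif : forall i : nat, uniform_on_cube (x i))
    (betaMM betaTSP : R)
    (hMM : is_beta x (@MM R d) betaMM)
    (hTSP : is_beta x (@TSP R d) betaTSP) :
  2 * betaMM < betaTSP.
Proof.
rewrite ltNge; apply/negP => le_beta.
(* An even [k] makes [k ^ d] equal to twice an integer [M]; the sample sizes [32 * M] form a
   subsequence along which both limits persist. *)
pose k r := (2 * r.+1)%N.
pose M r := (r.+1 * k r ^ d.-1)%N.
have k0 r : (0 < k r)%N by [].
have M0 r : (0 < M r)%N by rewrite muln_gt0 expn_gt0.
have kM r : (k r ^ d = 2 * M r)%N.
  by rewrite /M mulnA -/(k r) -expnS prednK //; lia.
pose n r := (32 * M r)%N.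
have ninf : n r @[r --> \oo] --> \oo.
  apply/cvgnyPge => A; near=> r; apply: (@leq_trans r); first by near: r; apply: nbhs_infty_ge.
  rewrite /n /M; have : (0 < k r ^ d.-1)%N by rewrite expn_gt0.
  by nia.
pose c : R := 146 * unit_len / 16 `^ ((d%:R - 1) / d%:R).
have c0 : 0 < c.
  have u0 := @unit_gt0 R.
  by rewrite divr_gt0 ?powR_gt0 // mulr_gt0.
pose g r w := good_fraction x (k r) (M r) w.
have g0 r w : 0 <= g r w by apply: good_fraction_ge0.
have g1 r w : g r w <= 1 by apply: good_fraction_le1.
have mg r : measurable_fun setT (EFin \o g r).
  by apply/measurable_EFinP; apply: measurable_good_fraction.
have g_cvg : {ae P, forall w, setT w -> (g r w)%:E @[r --> \oo] --> (cst 0%E w : \bar R)}.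
  apply: filterS2 hMM hTSP => w cM cT _.
  apply: cvg_EFin; first by apply: nearW.
  pose u m : R := TSP (first_points (fun l => x l w) m) / m%:R `^ ((d%:R - 1) / d%:R) -
    2 * (MM (first_points (fun l => x l w) m) / m%:R `^ ((d%:R - 1) / d%:R)).
  have cu : u m @[m --> \oo] --> betaTSP - 2 * betaMM.
    by apply: cvgB => //; apply: cvgM => //; apply: cvg_cst.
  have {}cu : u (n r) @[r --> \oo] --> betaTSP - 2 * betaMM by apply: cvg_comp ninf cu.
  (* As [betaTSP - 2 * betaMM] is assumed nonpositive, subtracting it from [u] keeps an upper bound
     for [c * g], and this bound tends to 0. *)
  have cv : c^-1 * (u (n r) - (betaTSP - 2 * betaMM)) @[r --> \oo] --> (0 : R).
    rewrite -[X in _ --> X](mulr0 c^-1) -(subrr (betaTSP - 2 * betaMM)).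
    by apply: cvgM; [apply: cvg_cst | apply: cvgB => //; apply: cvg_cst].
  apply: (squeeze_cvgr _ (cvg_cst 0) cv).
  apply: nearW => r /=; rewrite g0 /= ler_pdivlMl //.
  have := good_fraction_gain x hd (k0 r) (M0 r) (kM r) w (erefl (n r)).
  rewrite -/(u (n r)) -/(g r w) -/c; lra.
have ic : P.-integrable setT (cst 1%E : T -> \bar R).
  exact: finite_measure_integrable_cst.
have mc : measurable_fun setT (cst 0%E : T -> \bar R) by apply: measurable_cst.
have dom : {ae P, forall w r, setT w -> (`|(EFin \o g r) w| <= cst 1 w)%E}.
  by apply: aeW => w r _ /=; rewrite lee_fin ger0_norm.
have [_ _] := dominated_convergence measurableT mg mc g_cvg ic dom.
rewrite integral_cst // mul0e => cint.
(* The expectations of [g r] tend to 0 but have a positive lower bound free of [r]. *)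
have : (((tau (R:=R) (d:=d) ^+ d / 4) ^+ 32)%:E <= 0)%E.
  apply: (cvge_ge _ cint); apply: nearW => r.
  exact: expected_good_fraction.
by rewrite lee_fin leNgt exprn_gt0 // divr_gt0 // exprn_gt0 // tau_gt0.
Unshelve. all: by end_near. Qed.
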